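(* Let $k\ge1$, let $\delta t>0$ be arbitrary, let $\eta\in[0,1]$, and let $(\phi^n)_{0\le n\le N}$, $(\mu^{n+\frac12})_{1\le n\le N-1}$, $(\tilde q_i^{\,n+1})_{1\le n\le N-1}$ and $(q_i^n)_{1\le n\le N}$, $i=1,\dots,k$, satisfy the second-order RMSAV-CN scheme with time step $\delta t$ (defined in the context), with an arbitrary admissible relaxation parameter $\xi_0\in\mathcal V$ chosen at each step. Then the scheme is unconditionally energy stable: with $$E^{n}_{\mathrm{CN}}=\frac12\Big(\phi^{n},\Big(\mathcal L+\sum_{i=1}^k\gamma_i I\Big)\phi^{n}\Big)+\sum_{i=1}^k(q_i^{n})^2,$$ one has $E^{n+1}_{\mathrm{CN}}\le E^{n}_{\mathrm{CN}}$ for every $1\le n\le N-1$, with no restriction on the size of $\delta t$.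
   Context: Setting. $\Omega$ is a bounded rectangular domain with periodic boundary conditions; functions are real-valued and sufficiently regular for all expressions to make sense. $(f,g)=\int_\Omega fg\,d\mathbf x$ and $I$ is the identity operator. The free energy is $\mathcal E(\phi)=\int_\Omega\big(\frac12\phi\mathcal L\phi+\sum_{i=1}^kF_i(\phi)\big)d\mathbf x$, where $\mathcal L$ is a linear operator, symmetric with respect to $(\cdot,\cdot)$, and each $F_i:\mathbb R\to\mathbb R$ is continuously differentiable. The constants $\gamma_1,\dots,\gamma_k$ are real regularization parameters. The mobility $\mathcal G$ is an operator that is positive semidefinite, $(\mathcal G f,f)\ge 0$ for all $f$ (or skew-symmetric, in which case $(\mathcal G f,f)=0$). The gradient flow approximated is $\partial_t\phi=-\mathcal G(\mathcal L\phi+\sum_{i=1}^kF_i'(\phi))$. For $i=1,\dots,k$ put $$Q_i(\phi)=\sqrt{\int_\Omega\big(F_i(\phi)-\tfrac12\gamma_i\phi^2\big)d\mathbf x+C_i},\qquad V_i(\phi)=F_i'(\phi)-\gamma_i\phi,$$ where the constants $C_i>0$ are such that the quantities under the square roots are positive for all functions at which $Q_i$ is evaluated. RMSAV-CN scheme. Starting data $\phi^0,\phi^1$ (functions) and $q_i^1$ (real numbers, $i=1,\dots,k$) are given. For $1\le n\le N-1$, let $\overline\phi^{\,n+\frac12}=\frac32\phi^n-\frac12\phi^{n-1}$, $\phi^{n+\frac12}=\frac12(\phi^{n+1}+\phi^n)$ and $\tilde q_i^{\,n+\frac12}=\frac12(\tilde q_i^{\,n+1}+q_i^n)$. Step 1: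 $\phi^{n+1},\mu^{n+\frac12}$ (functions) and $\tilde q_1^{\,n+1},\dots,\tilde q_k^{\,n+1}$ (real numbers) satisfy $$\frac{\phi^{n+1}-\phi^n}{\delta t}=-\mathcal G\mu^{n+\frac12},$$ $$\mu^{n+\frac12}=\mathcal L\phi^{n+\frac12}+\sum_{i=1}^k\gamma_i\phi^{n+\frac12}+\sum_{i=1}^k\frac{\tilde q_i^{\,n+\frac12}}{Q_i(\overline\phi^{\,n+\frac12})}V_i(\overline\phi^{\,n+\frac12}),$$ $$\frac{\tilde q_j^{\,n+1}-q_j^n}{\delta t}=\int_\Omega\frac{V_j(\overline\phi^{\,n+\frac12})}{2Q_j(\overline\phi^{\,n+\frac12})}\,\frac{\phi^{n+1}-\phi^n}{\delta t}\,d\mathbf x,\quad j=1,\dots,k.$$ Step 2 (relaxation): $q_i^{n+1}=\xi_0\tilde q_i^{\,n+1}+(1-\xi_0)Q_i(\phi^{n+1})$, $i=1,\dots,k$, for some $\xi_0\in\mathcal V$ (the same for all $i$; it may depend on $n$), where $\mathcal V$ is the set of all $\xi\in[0,1]$ such that, with $r_i=\xi\tilde q_i^{\,n+1}+(1-\xi)Q_i(\phi^{n+1})$, $$\sum_{i=1}^k\Big[r_i^2-(\tilde q_i^{\,n+1})^2\Big]\le\delta t\,\eta\,(\mathcal G\mu^{n+\frac12},\mu^{n+\frac12}).$$ *)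

(* Defs.v *)
From HB Require Import structures.
From mathcomp Require Import all_boot all_order all_algebra.
From mathcomp Require Import all_classical all_reals all_analysis.
Set Implicit Arguments.
Unset Strict Implicit.
Unset Printing Implicit Defensive.
Import Order.TTheory GRing.Theory Num.Theory.
Import numFieldNormedType.Exports.
Local Open Scope classical_set_scope.
Local Open Scope ring_scope.

(* R^d; the library equips it with the product of the Borel sigma-algebras. *)
Notation Rd R d := (d.-tuple (measurableTypeR R)).

Definition consRd (R : realType) (d : nat) (p : measurableTypeR R * Rd R d) :
    Rd R d.+1 :=
  [tuple of p.1 :: p.2].
Arguments consRd : clear implicits.

Lemma measurable_consRd (R : realType) (d : nat) :
  measurable_fun [set: measurableTypeR R * Rd R d] (consRd R d).
Proof. exact: (measurable_cons measurable_fst measurable_snd). Qed.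

(* d-dimensional Lebesgue measure: iterated product of the one-dimensional one.
   Its value on boxes, which characterizes it, is given by leb_box. *)
Fixpoint leb (R : realType) (d : nat) : {measure set (Rd R d) -> \bar R} :=
  match d with
  | 0%N => \d_([tuple] : Rd R 0)
  | d'.+1 => measure_function_pushforward__canonical__measure_function_Measure
      (@lebesgue_measure R \x^ @leb R d')%E (@measurable_consRd R d')
  end.
Arguments leb : clear implicits.

Lemma leb0E (R : realType) :
  leb R 0 = \d_([tuple] : Rd R 0) :> (set _ -> _).
Proof. by []. Qed.

Lemma lebSE (R : realType) (d : nat) :
  leb R d.+1 = pushforward (@lebesgue_measure R \x^ leb R d)%E (consRd R d)
    :> (set _ -> _).
Proof. by []. Qed.

Definition box (R : realType) (d : nat) (a b : Rd R d) : set (Rd R d) :=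
  [set x | forall i, tnth a i < tnth x i < tnth b i].

Lemma measurable_box (R : realType) (d : nat) (a b : Rd R d) :
  measurable (box a b).
Proof.
have -> : box a b =
    \bigcap_(i in [set: 'I_d])
      ((@tnth d (measurableTypeR R))^~ i @^-1` `]tnth a i, tnth b i[).
  apply/seteqP; split => x /= H i.
    by move=> _ /=; rewrite in_itv/=; exact: H.
  by have /= := H i I; rewrite in_itv.
apply: fin_bigcap_measurable => // i _.
rewrite -[X in measurable X]setTI.
by apply: measurable_tnth => //; exact: measurable_itv.
Qed.

Lemma leb_box (R : realType) (d : nat) (a b : Rd R d) :
  (forall i, tnth a i <= tnth b i) ->
  leb R d (box a b) = (\prod_(i < d) (tnth b i - tnth a i))%:E.
Proof.
elim: d a b => [|d IH] a b ab.
  rewrite leb0E big_ord0 diracE mem_set //.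
  by case.
rewrite lebSE big_ord_recl EFinM.
case/tupleP: a ab => a0 a; case/tupleP: b => b0 b ab.
have ab' i : tnth a i <= tnth b i by have := ab (lift ord0 i); rewrite !tnthS.
have ab0 : a0 <= b0 by have := ab ord0; rewrite !tnth0.
under eq_bigr do rewrite !tnthS.
rewrite -IH // !tnth0 /pushforward.
have -> : consRd R d @^-1` box [tuple of a0 :: a] [tuple of b0 :: b] =
    (`]a0, b0[ : set R) `*` box a b.
  apply/seteqP; split => -[x y] /=.
    move=> H; split; first by have := H ord0; rewrite !tnth0 in_itv.
    by move=> i; have := H (lift ord0 i); rewrite !tnthS.
  rewrite in_itv /= => -[H1 H2] i.
  by case: (unliftP ord0 i) => [j|] ->; rewrite ?tnthS ?tnth0.
rewrite product_measure2E //; last exact: measurable_box.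
congr (_ * _)%E.
have := @lebesgue_measure_itv R `]a0, b0[; rewrite /= lte_fin => ->.
by case: ltgtP ab0 => // -> _; rewrite subrr.
Qed.

Definition translate (R : realType) (d : nat) (i : 'I_d) (l : R) (x : Rd R d) :
    Rd R d :=
  [tuple tnth x j + (if j == i then l else 0) | j < d].

Section Setting.
Variables (R : realType) (d : nat) (a b : Rd R d).
Implicit Types f g : Rd R d -> R.

Local Notation Omega := (box a b).

Definition periodic f : Prop :=
  forall (i : 'I_d) (x : Rd R d),
    f (translate i (tnth b i - tnth a i) x) = f x.

Definition integrable_on f : Prop :=
  (leb R d).-integrable Omega (fun x => (f x)%:E).

Definition integral_on f : R := \int[leb R d]_(x in Omega) f x.

Definition L2per f : Prop :=
  [/\ measurable_fun [set: Rd R d] f, periodic f &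
      integrable_on (fun x => f x ^+ 2)].

Definition ip f g : R := integral_on (fun x => f x * g x).

Definition aeq f g : Prop := f = g %[ae leb R d in Omega].

(* Operators are possibly unbounded: [A] is only meaningful on its domain [D]. *)
Definition operator (D : set (Rd R d -> R))
    (A : (Rd R d -> R) -> (Rd R d -> R)) : Prop :=
  forall f, D f -> L2per f /\ L2per (A f).

Definition linear_operator (D : set (Rd R d -> R))
    (A : (Rd R d -> R) -> (Rd R d -> R)) : Prop :=
  [/\ operator D A,
      D (fun=> 0),
      forall (c : R) f g, D f -> D g -> D (fun x => c * f x + g x) &
      forall (c : R) f g, D f -> D g ->
        aeq (A (fun x => c * f x + g x)) (fun x => c * A f x + A g x)].

Definition symmetric_operator (D : set (Rd R d -> R))
    (A : (Rd R d -> R) -> (Rd R d -> R)) : Prop :=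
  forall f g, D f -> D g -> ip (A f) g = ip f (A g).

Definition skew_symmetric_operator (D : set (Rd R d -> R))
    (A : (Rd R d -> R) -> (Rd R d -> R)) : Prop :=
  forall f g, D f -> D g -> ip (A f) g = - ip f (A g).

Definition psd_operator (D : set (Rd R d -> R))
    (A : (Rd R d -> R) -> (Rd R d -> R)) : Prop :=
  forall f, D f -> 0 <= ip (A f) f.

Definition C1 (F : R -> R) : Prop :=
  (forall s, derivable F s 1) /\ continuous (derive1 F).

Definition Qintegrand (F : R -> R) (gamma : R) f : Rd R d -> R :=
  fun x => F (f x) - gamma / 2 * f x ^+ 2.

Definition Q (F : R -> R) (gamma C : R) f : R :=
  Num.sqrt (integral_on (Qintegrand F gamma f) + C).

Definition Q_admissible (F : R -> R) (gamma C : R) f : Prop :=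
  integrable_on (Qintegrand F gamma f) /\
  0 < integral_on (Qintegrand F gamma f) + C.

Definition V (F : R -> R) (gamma : R) f : Rd R d -> R :=
  fun x => derive1 F (f x) - gamma * f x.

Section Scheme.
Variables (k : nat) (L G : (Rd R d -> R) -> (Rd R d -> R)).
Variables (F : 'I_k -> R -> R) (gamma C : 'I_k -> R).

Local Notation Qi i := (Q (F i) (gamma i) (C i)).
Local Notation Vi i := (V (F i) (gamma i)).

Definition energy_CN (phi : Rd R d -> R) (q : 'I_k -> R) : R :=
  2^-1 * ip phi (fun x => L phi x + (\sum_(i < k) gamma i) * phi x)
  + \sum_(i < k) q i ^+ 2.

Definition extrapolate (phim phi : Rd R d -> R) : Rd R d -> R :=
  fun x => 3 / 2 * phi x - 1 / 2 * phim x.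

Definition midpoint (phi phip : Rd R d -> R) : Rd R d -> R :=
  fun x => 1 / 2 * (phip x + phi x).

(* The set of relaxation parameters: [phip], [mu], [qtp] are the functions
   phi^{n+1}, mu^{n+1/2} and the numbers q~^{n+1}. *)
Definition relaxation_set (dt eta : R) (phip mu : Rd R d -> R)
    (qtp : 'I_k -> R) : set R :=
  [set xi | 0 <= xi <= 1 /\
    \sum_(i < k) ((xi * qtp i + (1 - xi) * Qi i phip) ^+ 2 - qtp i ^+ 2)
      <= dt * eta * ip (G mu) mu].

(* One step: [phim], [phi], [phip] are phi^{n-1}, phi^n, phi^{n+1}; [mu] is
   mu^{n+1/2}; [q], [qtp], [qp] are q^n, q~^{n+1}, q^{n+1}. *)
Definition RMSAV_CN_step (dt eta : R) (phim phi phip mu : Rd R d -> R)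
    (q qtp qp : 'I_k -> R) : Prop :=
  let phibar := extrapolate phim phi in
  let phih := midpoint phi phip in
  let qth i := 1 / 2 * (qtp i + q i) in
  [/\ aeq (fun x => (phip x - phi x) / dt) (fun x => - G mu x),
      aeq mu (fun x => L phih x + \sum_(i < k) gamma i * phih x
                       + \sum_(i < k) qth i / Qi i phibar * Vi i phibar x),
      forall j : 'I_k, (qtp j - q j) / dt =
        integral_on (fun x => Vi j phibar x / (2 * Qi j phibar)
                           * ((phip x - phi x) / dt)) &
      exists2 xi0 : R, relaxation_set dt eta phip mu qtp xi0 &
        forall i : 'I_k, qp i = xi0 * qtp i + (1 - xi0) * Qi i phip].

(* Regularity under which the expressions of one step are meaningful; Q_i is
   evaluated at phibar^{n+1/2} and phi^{n+1} only. *)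
Definition RMSAV_CN_step_regular (DL DG : set (Rd R d -> R))
    (phim phi phip mu : Rd R d -> R) : Prop :=
  let phibar := extrapolate phim phi in
  [/\ [/\ DL phim, DL phi & DL phip],
      DG mu,
      forall i : 'I_k, Q_admissible (F i) (gamma i) (C i) phibar,
      forall i : 'I_k, Q_admissible (F i) (gamma i) (C i) phip &
      forall i : 'I_k,
        integrable_on (fun x => Vi i phibar x * (phip x - phi x))].

End Scheme.
End Setting.

(* Main.v *)
Require Import Defs.
From HB Require Import structures.
From mathcomp Require Import all_boot all_order all_algebra.
From mathcomp Require Import all_classical all_reals all_analysis.
From mathcomp Require Import measurable_realfun.
From mathcomp Require Import ring lra.
Set Implicit Arguments.
Unset Strict Implicit.
Unset Printing Implicit Defensive.
Import Order.TTheory GRing.Theory Num.Theory.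
Import numFieldNormedType.Exports.
Local Open Scope classical_set_scope.
Local Open Scope ring_scope.

(** Each step satisfies an exact energy balance between the state with the old
    auxiliary variables q and the new state with the provisional ones q~: with
    A = L + (\sum_i gamma_i) I and w = phi^{n+1} - phi^n,

      <A phi^{n+1/2}, w> + \sum_i (q~_i ^+ 2 - q_i ^+ 2) = <mu, w>
                                                        = - dt <G mu, mu>.

    The second equality is the flow equation.  The first one tests the equation
    of the chemical potential with w: the update of q~_i turns the nonlinear
    term into (q~_i + q_i) (q~_i - q_i).  As A is symmetric, pairing the
    midpoint with the increment is an exact discrete chain rule
    ([midpoint_identity]), so the first term is the increment of
    1/2 <phi, A phi>; this gives [energy_CN_balance].

    The relaxation then replaces q~ by q^{n+1} and, by the definition of the
    admissible set, gives back at most dt eta <G mu, mu> of the energy that was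
    dissipated.  Since <G mu, mu> >= 0 ([ip_sign_ge0]) and eta <= 1, the net
    change, at most - dt (1 - eta) <G mu, mu>, is not positive.

    All the equations hold almost everywhere only and the operators are
    unbounded, so the algebra is backed by integrability: products of
    square-integrable functions are integrable ([L2per_mul]), whereas for the
    nonlinear terms only V_i w is known to be integrable. *)

(** * Linearity of the integral and the L2 pairing *)

Lemma integrable_on_lin (R : realType) (d : nat) (a b : Rd R d) (c : R)
    (f g : Rd R d -> R) :
  integrable_on a b f -> integrable_on a b g ->
  integrable_on a b (fun x => c * f x + g x).
Proof.
move=> fi gi; have mB := measurable_box a b.
exact: (integrableD mB (integrableZl mB c fi) gi).
Qed.

Lemma integral_on_lin (R : realType) (d : nat) (a b : Rd R d) (c : R)
    (f g : Rd R d -> R) :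
  integrable_on a b f -> integrable_on a b g ->
  integral_on a b (fun x => c * f x + g x) =
  c * integral_on a b f + integral_on a b g.
Proof.
move=> fi gi; have mB := measurable_box a b.
by rewrite /integral_on RintegralD ?RintegralZl//; exact: (integrableZl mB c fi).
Qed.

Lemma integrable_on0 (R : realType) (d : nat) (a b : Rd R d) :
  integrable_on a b (fun=> 0).
Proof. exact: integrable0. Qed.

Lemma integral_onZ (R : realType) (d : nat) (a b : Rd R d) (c : R)
    (f : Rd R d -> R) :
  integrable_on a b f ->
  integral_on a b (fun x => c * f x) = c * integral_on a b f.
Proof. by move=> fi; rewrite /integral_on RintegralZl//; exact: measurable_box. Qed.

Lemma integrable_on_sum (R : realType) (d : nat) (a b : Rd R d) (k : nat)
    (c : 'I_k -> R) (f : 'I_k -> Rd R d -> R) :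
  (forall i, integrable_on a b (f i)) ->
  integrable_on a b (fun x => \sum_(i < k) c i * f i x).
Proof.
move=> fi; elim: k c f fi => [|k IH] c f fi.
  by under eq_fun do rewrite big_ord0; exact: integrable_on0.
by under eq_fun do rewrite big_ord_recl; apply: integrable_on_lin => //; exact: IH.
Qed.

Lemma integral_on_sum (R : realType) (d : nat) (a b : Rd R d) (k : nat)
    (c : 'I_k -> R) (f : 'I_k -> Rd R d -> R) :
  (forall i, integrable_on a b (f i)) ->
  integral_on a b (fun x => \sum_(i < k) c i * f i x) =
  \sum_(i < k) c i * integral_on a b (f i).
Proof.
move=> fi; elim: k c f fi => [|k IH] c f fi.
  under [in LHS]eq_fun do rewrite big_ord0.
  by rewrite big_ord0 /integral_on /Rintegral integral0.
under [in LHS]eq_fun do rewrite big_ord_recl.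
by rewrite big_ord_recl integral_on_lin ?IH//; exact: integrable_on_sum.
Qed.

(** Integrability is required of both functions: Lebesgue measure on the Borel
    sigma-algebra is not complete, hence measurability does not pass from one
    of them to the other. *)
Lemma integral_on_ae (R : realType) (d : nat) (a b : Rd R d)
    (f g : Rd R d -> R) :
  integrable_on a b f -> integrable_on a b g -> aeq a b f g ->
  integral_on a b f = integral_on a b g.
Proof.
move=> fi gi fg; rewrite /integral_on /Rintegral; congr fine.
apply: ae_eq_integral.
- exact: measurable_box.
- exact: measurable_int fi.
- exact: measurable_int gi.
- exact: (ae_eq_comp EFin fg).
Qed.

(** By Young's inequality, |f g| <= f^2 + g^2. *)
Lemma L2per_mul (R : realType) (d : nat) (a b : Rd R d) (f g : Rd R d -> R) :
  L2per a b f -> L2per a b g -> integrable_on a b (fun x => f x * g x).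
Proof.
move=> [mf _ f2] [mg _ g2]; have mB := measurable_box a b.
apply: (le_integrable mB _ _ (integrable_on_lin 1 f2 g2)).
  apply/measurable_EFinP; apply: measurable_funTS; exact: measurable_funM.
move=> x _ /=; rewrite lee_fin mul1r.
rewrite [leRHS]ger0_norm ?addr_ge0 ?sqr_ge0// ler_norml; apply/andP.
by split; nra.
Qed.

Lemma L2per_lin (R : realType) (d : nat) (a b : Rd R d) (c : R)
    (f g : Rd R d -> R) :
  L2per a b f -> L2per a b g -> L2per a b (fun x => c * f x + g x).
Proof.
move=> Lf Lg; case: (Lf) (Lg) => mf pf f2 [mg pg g2]; split.
- by apply: measurable_funD => //; exact: measurable_funM.
- by move=> i x; rewrite pf pg.
- have -> : (fun x => (c * f x + g x) ^+ 2) =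
      (fun x => c ^+ 2 * f x ^+ 2 + ((2 * c) * (f x * g x) + g x ^+ 2)).
    by apply/funext => x; ring.
  by do 2!apply: integrable_on_lin => //; exact: L2per_mul.
Qed.

Lemma ipC (R : realType) (d : nat) (a b : Rd R d) (f g : Rd R d -> R) :
  ip a b f g = ip a b g f.
Proof. by rewrite /ip; congr integral_on; apply/funext => x; rewrite mulrC. Qed.

Lemma ip_linl (R : realType) (d : nat) (a b : Rd R d) (c : R)
    (f g h : Rd R d -> R) :
  L2per a b f -> L2per a b g -> L2per a b h ->
  ip a b (fun x => c * f x + g x) h = c * ip a b f h + ip a b g h.
Proof.
move=> Lf Lg Lh; rewrite /ip -integral_on_lin; try exact: L2per_mul.
by congr integral_on; apply/funext => x; ring.
Qed.

Lemma ip_linr (R : realType) (d : nat) (a b : Rd R d) (c : R)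
    (f g h : Rd R d -> R) :
  L2per a b f -> L2per a b g -> L2per a b h ->
  ip a b h (fun x => c * f x + g x) = c * ip a b h f + ip a b h g.
Proof. by move=> Lf Lg Lh; rewrite ipC ip_linl// !(ipC a b h). Qed.

Lemma ip_ael (R : realType) (d : nat) (a b : Rd R d) (f g h : Rd R d -> R) :
  L2per a b f -> L2per a b g -> L2per a b h -> aeq a b f g ->
  ip a b f h = ip a b g h.
Proof.
move=> Lf Lg Lh fg; apply: integral_on_ae; try exact: L2per_mul.
exact: (ae_eq_mul2r h fg).
Qed.

(** * Symmetric operators and the discrete chain rule *)

Section Shift.
Variables (R : realType) (d : nat) (a b : Rd R d).
Variables (D : set (Rd R d -> R)) (L : (Rd R d -> R) -> Rd R d -> R) (s : R).
Hypothesis linL : linear_operator a b D L.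

(** The shift by s I, with s the sum of the gamma_i, is kept inside the
    operator: the quadratic part of the energy then is a single quadratic form,
    to which [midpoint_identity] applies directly. *)
Lemma shift_operator_linear :
  linear_operator a b D (fun f x => s * f x + L f x).
Proof.
case: linL => op D0 Dl Ll; split => //.
  by move=> f Df; have [Lf LLf] := op _ Df; split=> //; exact: L2per_lin.
move=> c f g Df Dg; have := Ll c f g Df Dg; apply: filterS => x /= /[apply] ->.
by ring.
Qed.

Lemma shift_operator_symmetric : symmetric_operator a b D L ->
  symmetric_operator a b D (fun f x => s * f x + L f x).
Proof.
case: linL => op _ _ _ sym f g Df Dg.
have [Lf LLf] := op _ Df; have [Lg LLg] := op _ Dg.
by rewrite ip_linl// ip_linr// sym.
Qed.
End Shift.

(** With w = g - f, the midpoint is f + w / 2, and symmetry turns the expansion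
    of <A (f + w), f + w> into <A f, f> + 2 <A (f + w / 2), w>. *)
Lemma midpoint_identity (R : realType) (d : nat) (a b : Rd R d)
    (D : set (Rd R d -> R)) (A : (Rd R d -> R) -> Rd R d -> R)
    (f g : Rd R d -> R) :
  linear_operator a b D A -> symmetric_operator a b D A -> D f -> D g ->
  [/\ D (midpoint f g), D (fun x => g x - f x) &
    ip a b (A (midpoint f g)) (fun x => g x - f x) =
    2^-1 * ip a b g (A g) - 2^-1 * ip a b f (A f)].
Proof.
move=> [op D0 Dl Al] sym Df Dg.
set w := (fun x => g x - f x).
have wE : w = (fun x => -1 * f x + g x) by apply/funext => x; rewrite /w; ring.
have Dw : D w by rewrite wE; exact: Dl.
have mE : midpoint f g = (fun x => 1 / 2 * w x + f x).
  by apply/funext => x; rewrite /midpoint /w; field.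
have gE : g = (fun x => 1 * w x + f x) by apply/funext => x; rewrite /w; ring.
have Dm : D (midpoint f g) by rewrite mE; exact: Dl.
(* A is linear only up to a null set, which the pairing does not see. *)
have form_linl c u v h : D u -> D v -> D h ->
    ip a b (A (fun x => c * u x + v x)) h = c * ip a b (A u) h + ip a b (A v) h.
  move=> Du Dv Dh; have [Lh _] := op _ Dh; have [_ LAu] := op _ Du.
  have [_ LAv] := op _ Dv; have [_ LAuv] := op _ (Dl c _ _ Du Dv).
  by rewrite -ip_linl//; apply: ip_ael => //; [exact: L2per_lin|exact: Al].
have gg : ip a b (A g) g =
    ip a b (A w) w + 2 * ip a b (A f) w + ip a b (A f) f.
  have [[Lw _] [Lf LAf]] := (op _ Dw, op _ Df).
  have [_ LAw] := op _ Dw.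
  rewrite {1}gE form_linl//.
  rewrite gE !ip_linr// -?gE// (sym w f)// (ipC a b w (A f)); ring.
split => //; rewrite mE form_linl// (ipC a b g) gg (ipC a b f).
by field.
Qed.

(** In the skew-symmetric case <G f, f> equals its own opposite. *)
Lemma ip_sign_ge0 (R : realType) (d : nat) (a b : Rd R d)
    (D : set (Rd R d -> R)) (G : (Rd R d -> R) -> Rd R d -> R)
    (f : Rd R d -> R) :
  psd_operator a b D G \/ skew_symmetric_operator a b D G -> D f ->
  0 <= ip a b (G f) f.
Proof.
move=> [psd Df|skew Df]; first exact: psd.
by have := skew f f Df Df; rewrite [ip a b f (G f)]ipC => H; lra.
Qed.

(** * Energy balance of one step *)

(** The dissipation law before relaxation is an identity: inequalities enter
    only through the sign of the mobility and the relaxation. *)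
Lemma energy_CN_balance (R : realType) (d : nat) (a b : Rd R d)
    (DL DG : set (Rd R d -> R)) (L G : (Rd R d -> R) -> Rd R d -> R)
    (k : nat) (F : 'I_k -> R -> R) (gamma C : 'I_k -> R) (dt eta : R)
    (phim phi phip mu : Rd R d -> R) (q qtp qp : 'I_k -> R) :
  linear_operator a b DL L -> symmetric_operator a b DL L ->
  operator a b DG G -> dt != 0 ->
  RMSAV_CN_step_regular a b F gamma C DL DG phim phi phip mu ->
  RMSAV_CN_step a b L G F gamma C dt eta phim phi phip mu q qtp qp ->
  energy_CN a b L gamma phip qtp =
  energy_CN a b L gamma phi q - dt * ip a b (G mu) mu.
Proof.
move=> linL symL opG dt0 [[_ Df Dg] Dmu _ _ iVw] [flow muE qtE _].
set s := \sum_(i < k) gamma i.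
set A := (fun f x => s * f x + L f x).
have linA : linear_operator a b DL A by exact: shift_operator_linear.
have symA : symmetric_operator a b DL A by exact: shift_operator_symmetric.
have [Dm Dw AE] := midpoint_identity linA symA Df Dg.
set w := (fun x => phip x - phi x) in Dw AE *.
set m := midpoint phi phip in Dm AE *.
set phibar := extrapolate phim phi in muE qtE iVw.
set Qb := fun i => Q a b (F i) (gamma i) (C i) phibar in muE qtE.
set Vb := fun i => V (F i) (gamma i) phibar in muE qtE iVw.
have [opA _ _ _] := linA.
have [[Lw _] [_ LAm]] := (opA _ Dw, opA _ Dm).
have [Lmu LGmu] := opG _ Dmu.
have energyE f p : energy_CN a b L gamma f p =
    2^-1 * ip a b f (A f) + \sum_(i < k) p i ^+ 2.
  rewrite /energy_CN; congr (_ * ip a b f _ + _).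
  by apply/funext => x; rewrite addrC.
(* Testing the flow equation with mu. *)
have mu_flow : ip a b mu w = - (dt * ip a b (G mu) mu).
  rewrite [ip a b mu w]ipC -mulNr /ip -integral_onZ; last exact: L2per_mul.
  apply: integral_on_ae; [exact: L2per_mul| |].
    have := integrable_on_lin (- dt) (L2per_mul LGmu Lmu) (integrable_on0 a b).
    by under eq_fun do rewrite addr0.
  apply: filterS flow => x /= /[apply] wx.
  have -> : w x = - dt * G mu x.
    by rewrite mulNr -mulrN -wx mulrC divfK.
  by rewrite mulrA.
(* Testing the equation of the chemical potential with w. *)
have mu_chem : ip a b mu w =
    ip a b (A m) w + \sum_(i < k) (qtp i ^+ 2 - q i ^+ 2).
  transitivity (ip a b (A m) w +
      \sum_(i < k) (1 / 2 * (qtp i + q i) / Qb i) *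
        integral_on a b (fun x => Vb i x * w x)).
    rewrite -integral_on_sum// /ip -[X in X + _]mul1r -integral_on_lin.
    - apply: integral_on_ae; first exact: L2per_mul.
        apply: integrable_on_lin; first exact: L2per_mul.
        exact: integrable_on_sum.
      apply: filterS muE => x /= /[apply] ->.
      have -> : A m x = L m x + \sum_(i < k) gamma i * m x.
        by rewrite /A addrC /s mulr_suml.
      rewrite mulrDl [X in _ + X = _]mulr_suml; congr (_ + _).
        by rewrite [RHS]mul1r.
      by apply: eq_bigr => i _; rewrite mulrA.
    - exact: L2per_mul.
    - exact: integrable_on_sum.
  congr (_ + _); apply: eq_bigr => i _.
  (* The coefficient of V_i is q~_i + q_i times the one in the update of q~_i,
     which produces a difference of squares. *)
  have /(congr1 (fun y => y * dt)) := qtE i.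
  rewrite divfK// => qtiE.
  have -> : qtp i ^+ 2 - q i ^+ 2 = (qtp i + q i) * (qtp i - q i) by ring.
  rewrite qtiE.
  have -> : integral_on a b (fun x => Vb i x / (2 * Qb i) * (w x / dt)) =
      integral_on a b (fun x => ((2 * Qb i)^-1 / dt) * (Vb i x * w x)).
    by congr integral_on; apply/funext => x; rewrite mulrACA mulrC.
  rewrite (integral_onZ _ (iVw i)) invfM; move: (Qb i)^-1 => Qinv; field.
  exact: dt0.
rewrite !energyE; move: mu_chem; rewrite mu_flow AE sumrB => ?; lra.
Qed.

Theorem theorem3p4 (R : realType)
  (d : nat) (hd : (0 < d)%N) (a b : Rd R d)
  (hab : forall i : 'I_d, tnth a i < tnth b i)
  (DL : set (Rd R d -> R)) (L : (Rd R d -> R) -> (Rd R d -> R))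
  (hLlin : linear_operator a b DL L) (hLsym : symmetric_operator a b DL L)
  (DG : set (Rd R d -> R)) (G : (Rd R d -> R) -> (Rd R d -> R))
  (hG : operator a b DG G)
  (hGsign : psd_operator a b DG G \/ skew_symmetric_operator a b DG G)
  (k : nat) (hk : (1 <= k)%N)
  (F : 'I_k -> R -> R) (hF : forall i : 'I_k, C1 (F i))
  (gamma C : 'I_k -> R) (hC : forall i : 'I_k, 0 < C i)
  (dt : R) (hdt : 0 < dt) (eta : R) (heta : 0 <= eta <= 1)
  (N : nat)
  (phi : nat -> Rd R d -> R)
  (mu : nat -> Rd R d -> R) (* mu n is mu^{n+1/2} *)
  (qt q : nat -> 'I_k -> R)
  (hreg : forall n : nat, (1 <= n < N)%N ->
    RMSAV_CN_step_regular a b F gamma C DL DG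
      (phi n.-1) (phi n) (phi n.+1) (mu n))
  (hscheme : forall n : nat, (1 <= n < N)%N ->
    RMSAV_CN_step a b L G F gamma C dt eta
      (phi n.-1) (phi n) (phi n.+1) (mu n) (q n) (qt n.+1) (q n.+1)) :
  forall n : nat, (1 <= n < N)%N ->
    energy_CN a b L gamma (phi n.+1) (q n.+1)
      <= energy_CN a b L gamma (phi n) (q n).
Proof.
move=> n nN; have reg := hreg n nN; have step := hscheme n nN.
have bal := energy_CN_balance hLlin hLsym hG (lt0r_neq0 hdt) reg step.
have [_ Dmu _ _ _] := reg; have diss := ip_sign_ge0 hGsign Dmu.
have [_ _ _ [xi0 [_ relax] qE]] := step.
have relaxE : \sum_(i < k) q n.+1 i ^+ 2 - \sum_(i < k) qt n.+1 i ^+ 2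
    <= dt * eta * ip a b (G (mu n)) (mu n).
  by rewrite -sumrB; under eq_bigr do rewrite qE.
(* The part of the dissipation that the relaxation cannot use up. *)
have slack : 0 <= dt * (1 - eta) * ip a b (G (mu n)) (mu n).
  have [_ eta1] := andP heta.
  by rewrite mulr_ge0// mulr_ge0 ?subr_ge0// ltW.
by move: bal relaxE slack; rewrite /energy_CN => *; lra.
Qed.
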